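(* Let $n\ge 1$ and $r$ be integers with $0\leq r\leq n-1$. Among all graphs on $n$ vertices with $r$ pendent vertices, $G_{n,r}$ is the unique graph (up to isomorphism) which has maximum $SLEE$.
   Context: All graphs are finite and simple. For a graph $G$ on $n$ vertices, let $\mathbf{Q}(G)=\mathbf{D}(G)+\mathbf{A}(G)$ be its signless Laplacian matrix, where $\mathbf{A}(G)$ is the adjacency matrix and $\mathbf{D}(G)$ the diagonal matrix of vertex degrees; let $q_1,\dots,q_n$ be the eigenvalues of $\mathbf{Q}(G)$. The signless Laplacian Estrada index of $G$ is $SLEE(G)=\sum_{i=1}^n e^{q_i}$. A pendent vertex is a vertex of degree $1$. $K_m$ is the complete graph on $m$ vertices. For $a\geq 1$ and $b\geq 0$, $G_{a+b,b}$ is the graph on $a+b$ vertices obtained from $K_a$ by adding $b$ new vertices, each joined by a single edge to one and the same vertex of $K_a$; thus $G_{n,r}$ is obtained from $K_{n-r}$ by attaching $r$ new vertices to one fixed vertex of $K_{n-r}$.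
   Formalization: For ''exactly r pendent vertices'' the cases n = r+2 and (n,r) = (2,1) are excluded, since there G_{n,r} itself does not have exactly r pendent vertices; for ''at least r pendent vertices'' the claim is proved for all 0 ≤ r ≤ n-1. *)

(* Defs.v *)
From HB Require Import structures.
From mathcomp Require Import all_boot all_order all_algebra.
From mathcomp Require Import polyrcf complex.
From mathcomp Require Import spectral reals sequences.
From mathcomp Require Import exp.

Set Implicit Arguments.
Unset Strict Implicit.
Unset Printing Implicit Defensive.

Import Order.TTheory GRing.Theory Num.Theory.
Local Open Scope ring_scope.

Record sgraph (n : nat) := SGraph {
  adj :> rel 'I_n;
  adj_sym : symmetric adj;
  adj_irr : irreflexive adj }.

Definition isomorphic n (G H : sgraph n) : Prop :=
  exists2 f : 'I_n -> 'I_n, bijective f & forall x y, H (f x) (f y) = G x y.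

Definition degree n (G : sgraph n) (x : 'I_n) : nat := #|[set y | G x y]|.

Definition pendent n (G : sgraph n) : {set 'I_n} := [set x | degree G x == 1%N].

Definition adjacency_mx (R : pzRingType) n (G : sgraph n) : 'M[R]_n :=
  \matrix_(i, j) (G i j)%:R.

Definition degree_mx (R : pzRingType) n (G : sgraph n) : 'M[R]_n :=
  diag_mx (\row_i (degree G i)%:R).

Definition signless_laplacian (R : pzRingType) n (G : sgraph n) : 'M[R]_n :=
  degree_mx R G + adjacency_mx R G.

(* The real eigenvalues, each listed with its algebraic multiplicity; for a
   symmetric matrix this is the whole spectrum (see char_poly_eigenvalues). *)
Definition eigenvalues (R : realType) n (A : 'M[R]_n) : seq R :=
  flatten [seq nseq (mup x (char_poly A)) x | x <- rootsR (char_poly A)].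

Definition SLEE (R : realType) n (G : sgraph n) : R :=
  \sum_(q <- eigenvalues (signless_laplacian R G)) expR q.

(* G_{n,r}: the vertices i < n - r form the clique K_{n-r}, and the r vertices
   i >= n - r are each joined to the vertex 0 only. *)
Definition Gnr_rel (n r : nat) : rel 'I_n := fun x y =>
  (x != y) && [|| (x < n - r)%N && (y < n - r)%N,
                  (x == 0 :> nat) && (n - r <= y)%N
                | (y == 0 :> nat) && (n - r <= x)%N].

Lemma Gnr_sym n r : symmetric (@Gnr_rel n r).
Proof.
by move=> x y; rewrite /Gnr_rel eq_sym andbC [in LHS]andbC; congr (_ && _);
   rewrite [(y < _)%N && _]andbC; congr (_ || _); rewrite orbC.
Qed.

Lemma Gnr_irr n r : irreflexive (@Gnr_rel n r).
Proof. by move=> x; rewrite /Gnr_rel eqxx. Qed.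

Definition Gnr (n r : nat) : sgraph n := SGraph (@Gnr_sym n r) (@Gnr_irr n r).

Definition unique_max_SLEE (R : realType) n (P : sgraph n -> Prop)
    (G : sgraph n) : Prop :=
  P G /\ forall H : sgraph n, P H ->
    SLEE R H <= SLEE R G /\ (SLEE R H = SLEE R G -> isomorphic H G).

Lemma signless_laplacian_sym (R : pzRingType) n (G : sgraph n) :
  (signless_laplacian R G)^T = signless_laplacian R G.
Proof.
rewrite /signless_laplacian linearD /= tr_diag_mx; congr (_ + _).
by apply/matrixP => i j; rewrite !mxE adj_sym.
Qed.

Lemma char_poly_diag (K : comNzRingType) n (d : 'rV[K]_n) :
  char_poly (diag_mx d) = \prod_i ('X - (d 0 i)%:P).
Proof.
rewrite char_poly_trig ?diag_mx_is_trig //.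
by apply: eq_bigr => i _; rewrite mxE eqxx mulr1n.
Qed.

Lemma char_poly_conj (K : comUnitRingType) n (P A : 'M[K]_n) :
  P \in unitmx -> char_poly (invmx P *m A *m P) = char_poly A.
Proof.
move=> Pu; pose Q := map_mx polyC P; pose Q' := map_mx polyC (invmx P).
have QQ : Q' *m Q = 1%:M by rewrite -map_mxM mulVmx // map_mx1.
rewrite /char_poly.
have -> : char_poly_mx (invmx P *m A *m P) = Q' *m char_poly_mx A *m Q.
  rewrite /char_poly_mx !map_mxM mulmxBr mulmxBl; congr (_ - _).
  by rewrite scalar_mxC -mulmxA QQ mulmx1.
rewrite !det_mulmx mulrAC -det_mulmx QQ det1 mul1r //.
Qed.

Lemma mup_prodXsubC (R : fieldType) (s : seq R) x :
  mup x (\prod_(q <- s) ('X - q%:P)) = count_mem x s.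
Proof.
elim: s => [|a s IHs]; first by rewrite big_nil mupNroot ?root1.
rewrite big_cons mupM ?polyXsubC_eq0 //; last first.
  by apply: monic_neq0; apply: monic_prod_XsubC.
by rewrite IHs -['X - a%:P]expr1 mup_XsubCX /=; case: eqP.
Qed.

Lemma rootsR_prod (R : rcfType) (s : seq R)
    (p := \prod_(q <- s) ('X - q%:P)) :
  perm_eq s (flatten [seq nseq (mup x p) x | x <- rootsR p]).
Proof.
have p0 : p != 0 by apply: monic_neq0; apply: monic_prod_XsubC.
apply/allP => x _ /=; apply/eqP.
have E : count_mem x s = mup x p by rewrite mup_prodXsubC.
rewrite count_flatten -map_comp E.
have rP := roots_on_rootsR p0.
have uR : uniq (rootsR p) by exact: uniq_roots.
have memR : (x \in rootsR p) = root p x by rewrite -rP.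
rewrite sumnE big_map.
under eq_bigr do rewrite /= count_nseq /=.
have [xr|xr] := boolP (root p x).
  rewrite (bigD1_seq x) //= ?memR // eqxx mul1n big1 ?addn0 // => y /negPf yx.
  by rewrite yx.
rewrite mupNroot // big_seq big1 // => y; rewrite -rP /= => yr.
by case: eqP => [yx|_] //; move: xr; rewrite -yx yr.
Qed.

Lemma char_poly_eigenvalues (R : realType) n (A : 'M[R]_n) : A^T = A ->
  char_poly A = \prod_(q <- eigenvalues A) ('X - q%:P).
Proof.
move=> symA.
suff [s E] : exists s, char_poly A = \prod_(q <- s) ('X - q%:P).
  rewrite /eigenvalues E; apply: perm_big; exact: rootsR_prod.
pose C := R[i]; pose f := real_complex R.
pose B : 'M[C]_n := map_mx f A.
have hB : B \is hermsymmx.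
  apply: realsym_hermsym.
    apply/is_hermitianmxP; rewrite expr0 scale1r; apply/matrixP => i j.
    by rewrite !mxE /= -[in LHS]symA mxE.
  by apply/mxOverP => i j; rewrite mxE complex_real.
have /orthomx_spectralP EB := hermitian_normalmx hB.
have dR := hermitian_spectral_diag_real hB.
set d := spectral_diag B in EB dR.
exists [seq complex.Re (d 0 i) | i <- index_enum 'I_n].
apply: (map_poly_inj f); rewrite map_char_poly -/B.
rewrite EB char_poly_conj ?spectral_unit // char_poly_diag big_map rmorph_prod.
apply: eq_bigr => i _.
rewrite /= rmorphB /= map_polyX map_polyC /=; congr ('X - _%:P).
by rewrite RRe_real //; move/mxOverP: dR; apply.
Qed.

(* Main.v *)
Require Import Defs.
From HB Require Import structures.
From mathcomp Require Import all_boot all_order all_algebra fingroup perm.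
From mathcomp Require Import polyrcf complex spectral reals topology normedtype.
From mathcomp Require Import sequences exp ring zify.

(* Write q_1, ..., q_n for the eigenvalues of Q = Q(H), so that SLEE(H) is the
   sum over k of tr(Q^k)/k!. We show tr(Q(H)^k) <= tr(Q(G_{n,r})^k) for every k;
   equality of SLEE then forces equality for every k.

   Label H so that the vertices s >= m = n - r are pendent, with neighbours f s.
   Then Q = A + U V, where A is the signless Laplacian of the graph induced on
   {x < m} and U, V collect the pendent edges. As tr((A + U V)^k) is a
   polynomial with nonnegative coefficients in the numbers tr(A^i) and the
   entries of V A^i U, it suffices to compare these. The entry (s, t) of V A^i U
   is essentially (A^i)_{f s, f t}; it is at most the corresponding entry for
   K_m, which is largest on the diagonal, and there it does not depend on the
   vertex: so attaching all leaves to one vertex is optimal.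

   In case of equality, k = 1 says that H has as many edges as possible (H is
   complete on {x < m}, no two leaves are adjacent), and the (V U)^2 term of
   k = 2 says that any two leaves have the same neighbour. *)

Set Implicit Arguments.
Unset Strict Implicit.
Unset Printing Implicit Defensive.

Import Order.TTheory GRing.Theory Num.Theory.
Import numFieldNormedType.Exports.
Local Open Scope ring_scope.

(** * Power sums of the eigenvalues *)

Lemma trace_exp_conj (K : comUnitRingType) n (P A : 'M[K]_n) k :
  P \in unitmx -> \tr ((invmx P *m A *m P) ^+ k) = \tr (A ^+ k).
Proof.
move=> Pu; have -> : (invmx P *m A *m P) ^+ k = invmx P *m A ^+ k *m P.
  elim: k => [|k IHk]; first by rewrite !expr0 mulmx1 mulVmx.
  rewrite !exprS IHk -!mulmxE !mulmxA; congr (_ *m _ *m _).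
  by rewrite -!mulmxA mulmxV // mulmx1.
by rewrite mxtrace_mulC mulmxA mulmxV // mul1mx.
Qed.

Lemma trace_exp_diag (K : comNzRingType) n (d : 'rV[K]_n) k :
  \tr (diag_mx d ^+ k) = \sum_i d 0 i ^+ k.
Proof.
have -> : diag_mx d ^+ k = diag_mx (\row_i d 0 i ^+ k).
  elim: k => [|k IHk].
    by rewrite expr0; apply/matrixP => i j; rewrite !mxE expr0.
  rewrite exprS IHk -mulmxE mulmx_diag; congr diag_mx.
  by apply/rowP => i; rewrite !mxE exprS.
by rewrite mxtrace_diag; apply: eq_bigr => i _; rewrite mxE.
Qed.

Lemma perm_eq_prod_XsubC (F : fieldType) (s t : seq F) :
  \prod_(q <- s) ('X - q%:P) = \prod_(q <- t) ('X - q%:P) -> perm_eq s t.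
Proof.
by move=> E; apply/allP => x _ /=; rewrite -!mup_prodXsubC E.
Qed.

(** By the spectral theorem over [R[i]], the trace is the power sum of the spectral diagonal. That
    diagonal and [eigenvalues A] both split the characteristic polynomial, so they agree as
    multisets. *)
Lemma trace_exp_eigenvalues (R : realType) n (A : 'M[R]_n) k : A^T = A ->
  \tr (A ^+ k) = \sum_(q <- eigenvalues A) q ^+ k.
Proof.
move=> symA; pose f := real_complex R; pose B := map_mx f A.
have hB : B \is hermsymmx.
  apply: realsym_hermsym; last by apply/mxOverP => i j; rewrite mxE complex_real.
  apply/is_hermitianmxP; rewrite expr0 scale1r; apply/matrixP => i j.
  by rewrite !mxE /= -[in LHS]symA mxE.
have /orthomx_spectralP EB := hermitian_normalmx hB.
apply: (fmorph_inj f); rewrite -trace_map_mx rmorph_sum /=.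
have -> : map_mx f (A ^+ k) = B ^+ k.
  elim: k => [|k IHk]; first by rewrite !expr0 map_mx1.
  by rewrite !exprS -!mulmxE map_mxM IHk.
rewrite EB trace_exp_conj ?spectral_unit // trace_exp_diag.
have: perm_eq [seq f q | q <- eigenvalues A]
              [seq spectral_diag B 0 i | i <- index_enum 'I_n].
  apply: perm_eq_prod_XsubC; rewrite !big_map -char_poly_diag.
  by rewrite -(char_poly_conj _ (spectral_unit B)) -EB -map_char_poly
             char_poly_eigenvalues // rmorph_prod; apply: eq_bigr => q _;
     rewrite rmorphB /= map_polyX map_polyC.
move=> pE; rewrite -(big_map (spectral_diag B 0) xpredT (fun z => z ^+ k)).
by rewrite -(perm_big _ pE) big_map; apply: eq_bigr => q _; exact/esym/rmorphXn.
Qed.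

(** * Exponential sums compared through power sums *)

Section ExponentialSums.
Local Open Scope classical_set_scope.

Lemma series_sum_expR (R : realType) (s : seq R) :
  (series (fun k => \sum_(q <- s) exp_coeff q k) @ \oo -->
   \sum_(q <- s) expR q).
Proof.
elim: s => [|a s IHs].
  rewrite big_nil (_ : series _ = (fun=> 0)); first exact: cvg_cst.
  apply/boolp.funext => k; rewrite /series /= big1 // => i _.
  by rewrite big_nil.
rewrite big_cons (_ : series _ = series (exp_coeff a) \+
    series (fun k => \sum_(q <- s) exp_coeff q k)).
  by apply: cvgD IHs; exact: is_cvg_series_exp_coeff.
apply/boolp.funext => k; rewrite /series /= -big_split.
by apply: eq_bigr => i _; rewrite big_cons.
Qed.

(** The difference of the exponential series has nonnegative terms, so each single term is a lower
    bound for its sum. This quantitative form serves both the inequality and the equality case. *)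
Lemma sum_expR_gap (R : realType) (s t : seq R) k :
  (forall j, \sum_(q <- s) q ^+ j <= \sum_(q <- t) q ^+ j) ->
  (\sum_(q <- t) q ^+ k - \sum_(q <- s) q ^+ k) / k`!%:R <=
  \sum_(q <- t) expR q - \sum_(q <- s) expR q.
Proof.
move=> le_st; pose u j := \sum_(q <- t) exp_coeff q j - \sum_(q <- s) exp_coeff q j.
have uE j : u j = (\sum_(q <- t) q ^+ j - \sum_(q <- s) q ^+ j) / j`!%:R.
  by rewrite /u /exp_coeff /= mulrBl !mulr_suml.
have u_ge0 j : 0 <= u j by rewrite uE divr_ge0 ?subr_ge0.
have u_cvg : (series u @ \oo --> \sum_(q <- t) expR q - \sum_(q <- s) expR q).
  have -> : series u = series (fun k => \sum_(q <- t) exp_coeff q k) \-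
                       series (fun k => \sum_(q <- s) exp_coeff q k).
    by apply/boolp.funext => j; rewrite /series /= -sumrB.
  by apply: cvgB; exact: series_sum_expR.
have u_le : u k <= series u k.+1.
  by rewrite /series /= big_nat_recr //= lerDr; apply: sumr_ge0.
rewrite -uE (le_trans u_le) // -(cvg_lim _ u_cvg) //.
apply: nondecreasing_cvgn_le; last by apply/cvg_ex; eexists; exact: u_cvg.
by apply/nondecreasing_seqP => j; rewrite /series /= big_nat_recr //= lerDl.
Qed.

End ExponentialSums.

(** * Traces of powers of A + U V *)

Section TraceComparison.
Variable R : realDomainType.

Lemma addmxE p q (A B : 'M[R]_(p, q)) i j : (A + B) i j = A i j + B i j.
Proof. by rewrite mxE. Qed.

Lemma mulmx_entry_le p q r (A A' : 'M[R]_(p, q)) (B B' : 'M[R]_(q, r)) :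
  (forall i j, 0 <= A i j <= A' i j) -> (forall i j, 0 <= B i j <= B' i j) ->
  forall i j, 0 <= (A *m B) i j <= (A' *m B') i j.
Proof.
move=> AA BB i j; rewrite !mxE; apply/andP; split.
  by apply: sumr_ge0 => k _; case/andP: (AA i k) (BB k j) => ? _ /andP[? _]; rewrite mulr_ge0.
by apply: ler_sum => k _; case/andP: (AA i k) (BB k j) => ? ? /andP[? ?]; rewrite ler_pM.
Qed.

Lemma expmx_entry_le n (A A' : 'M[R]_n) k :
  (forall i j, 0 <= A i j <= A' i j) ->
  forall i j, 0 <= (A ^+ k) i j <= (A' ^+ k) i j.
Proof.
move=> AA; elim: k => [|k IHk] i j.
  by rewrite !expr0 !mxE lexx andbT ler0n.
by rewrite !exprS -!mulmxE mulmx_entry_le.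
Qed.

Lemma trace_le n (A A' : 'M[R]_n) :
  (forall i j, 0 <= A i j <= A' i j) -> \tr A <= \tr A'.
Proof. by move=> AA; apply: ler_sum => i _; case/andP: (AA i i). Qed.

Section Perturbation.
Variables (n r : nat) (A A' : 'M[R]_n).
Variables (U U' : 'M[R]_(n, r)) (V V' : 'M[R]_(r, n)).
Let Q := A + U *m V.
Let Q' := A' + U' *m V'.

Hypothesis VAU_le : forall k i j,
  0 <= (V *m A ^+ k *m U) i j <= (V' *m A' ^+ k *m U') i j.
Hypothesis trA_le : forall k, \tr (A ^+ k) <= \tr (A' ^+ k).

(** The leftmost factor of the power is expanded. The trivial factor [B ^+ 0] gives the last summand
    the shape of the left-hand side, so that an induction on [k] for all [i] applies to it. *)
Lemma compress_expSr (B : 'M[R]_n) (W : 'M[R]_(n, r)) (Z : 'M[R]_(r, n)) i k :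
  Z *m B ^+ i *m (B + W *m Z) ^+ k.+1 *m W =
  Z *m B ^+ i.+1 *m (B + W *m Z) ^+ k *m W +
  (Z *m B ^+ i *m W) *m (Z *m B ^+ 0 *m (B + W *m Z) ^+ k *m W).
Proof.
rewrite exprS -mulmxE exprSr -mulmxE expr0 mulmx1.
by rewrite !mulmxDl !mulmxDr !mulmxA !mulmxDl.
Qed.

(** The rightmost factor is expanded, and cyclicity of the trace brings [B] or [Z] to the front. *)
Lemma trace_expSr (B : 'M[R]_n) (W : 'M[R]_(n, r)) (Z : 'M[R]_(r, n)) i k :
  \tr (B ^+ i *m (B + W *m Z) ^+ k.+1) =
  \tr (B ^+ i.+1 *m (B + W *m Z) ^+ k) +
  \tr (Z *m B ^+ i *m (B + W *m Z) ^+ k *m W).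
Proof.
rewrite exprSr -mulmxE !mulmxDr mxtraceD; congr (_ + _).
  by rewrite mulmxA mxtrace_mulC mulmxA exprS.
by rewrite !mulmxA mxtrace_mulC !mulmxA.
Qed.

Lemma compress_exp_le i k s t :
  0 <= (V *m A ^+ i *m Q ^+ k *m U) s t <= (V' *m A' ^+ i *m Q' ^+ k *m U') s t.
Proof.
elim: k i s t => [|k IHk] i s t; first by rewrite !expr0 !mulmx1.
rewrite !compress_expSr !addmxE.
have /andP[a b] := IHk i.+1 s t.
have /andP[c d] := mulmx_entry_le (VAU_le i) (IHk 0) s t.
by rewrite addr_ge0 //= lerD.
Qed.

Lemma trace_exp_perturb_le k : \tr (Q ^+ k) <= \tr (Q' ^+ k).
Proof.
suff le i : \tr (A ^+ i *m Q ^+ k) <= \tr (A' ^+ i *m Q' ^+ k).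
  by have := le 0; rewrite !expr0 !mul1mx.
elim: k i => [|k IHk] i; first by rewrite !expr0 !mulmx1.
rewrite !trace_expSr lerD // trace_le //; exact: compress_exp_le.
Qed.

Lemma trace_exp1_perturb_eq : \tr Q = \tr Q' ->
  \tr A = \tr A' /\ \tr (V *m U) = \tr (V' *m U').
Proof.
rewrite !mxtraceD [\tr (U *m V)]mxtrace_mulC [\tr (U' *m V')]mxtrace_mulC => E.
have le1 := trA_le 1; rewrite !expr1 in le1.
have le2 := trace_le (VAU_le 0); rewrite !expr0 !mulmx1 in le2.
by move/eqP: E; rewrite eq_le => /andP[_ E]; split; apply/eqP; rewrite eq_le ?le1 ?le2 /=;
  [rewrite -(lerD2r (\tr (V *m U))) (le_trans _ E) ?lerD2l
  |rewrite -(lerD2l (\tr A)) (le_trans _ E) ?lerD2r].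
Qed.

(** In tr(Q^2) = tr(A^2) + 2 tr(V A U) + tr((V U)^2) every summand can only grow from [Q] to [Q'],
    so equal totals force equal last summands. *)
Lemma trace_exp2_perturb_eq : \tr (Q ^+ 2) = \tr (Q' ^+ 2) ->
  \tr ((V *m U) *m (V *m U)) = \tr ((V' *m U') *m (V' *m U')).
Proof.
have E (B : 'M[R]_n) (W : 'M[R]_(n, r)) (Z : 'M[R]_(r, n)) :
    \tr ((B + W *m Z) ^+ 2) =
    \tr (B ^+ 2) + \tr (Z *m B ^+ 1 *m W) + \tr (Z *m B ^+ 1 *m W) +
    \tr ((Z *m W) *m (Z *m W)).
  rewrite -[X in \tr X = _]mul1mx -[1%:M](expr0 B) !trace_expSr expr0 mulmx1.
  rewrite compress_expSr mxtraceD !expr0 !mulmx1.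
  by rewrite -!addrA.
rewrite !E => e.
have h := trace_le (VAU_le 1).
have le : \tr (A ^+ 2) + \tr (V *m A ^+ 1 *m U) + \tr (V *m A ^+ 1 *m U) <=
   \tr (A' ^+ 2) + \tr (V' *m A' ^+ 1 *m U') + \tr (V' *m A' ^+ 1 *m U').
  by rewrite !lerD.
have VU_le := VAU_le 0; rewrite !expr0 !mulmx1 in VU_le.
apply/eqP; rewrite eq_le (trace_le (mulmx_entry_le VU_le VU_le)) /=.
rewrite -(lerD2l (\tr (A ^+ 2) + \tr (V *m A ^+ 1 *m U) + \tr (V *m A ^+ 1 *m U))).
by rewrite e lerD2r.
Qed.

End Perturbation.
End TraceComparison.

(** * Splitting off the leaves of a graph *)

Section LeafDecomposition.
Variable R : realDomainType.
Implicit Types (n m : nat).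

Lemma sum_delta (I : finType) (a : I) (F : I -> R) :
  \sum_x (x == a)%:R * F x = F a.
Proof.
rewrite (bigD1 a) //= eqxx mul1r big1 ?addr0 // => x /negPf ->.
exact: mul0r.
Qed.

Lemma degreeE n (G : sgraph n) x : (degree G x)%:R = \sum_y (G x y)%:R :> R.
Proof.
rewrite /degree -sum1_card natr_sum big_mkcond.
by apply: eq_bigr => y _; rewrite inE; case: (G x y).
Qed.

Lemma signless_laplacianE n (G : sgraph n) x y :
  signless_laplacian R G x y = (x == y)%:R * (\sum_z (G x z)%:R) + (G x y)%:R.
Proof. by rewrite !mxE degreeE mulr_natl. Qed.

(** The signless Laplacian of the subgraph induced on {x < m}, padded with zeros to size [n]. *)
Definition core_mx n m (G : sgraph n) : 'M[R]_n :=
  \matrix_(x < n, y < n) if (x < m)%N && (y < m)%N then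
    (x == y)%:R * (\sum_(z < n | (z < m)%N) (G x z)%:R) + (G x y)%:R else 0.

(** Row [s] is the incidence vector of the pendent edge at the leaf [s]; the rows below [m] are
    padding. *)
Definition leaf_out n m (f : 'I_n -> 'I_n) : 'M[R]_n :=
  \matrix_(s < n, x < n) if (m <= s)%N then (x == s)%:R + (x == f s)%:R else 0.

(* If [s] and [f s] are both leaves, column [s] is the unit vector of [s]
   alone, so that the edge between them is not counted twice. *)
Definition leaf_in n m (f : 'I_n -> 'I_n) : 'M[R]_n :=
  \matrix_(x < n, s < n) if (m <= s)%N then
    (x == s)%:R + (f s < m)%N%:R * (x == f s)%:R else 0.

Definition leaves_at n m (f : 'I_n -> 'I_n) (G : sgraph n) :=
  forall s y : 'I_n, (m <= s)%N -> G s y = (y == f s).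

(** The signless Laplacian is the sum of (e_x + e_y)(e_x + e_y)^T over the edges xy. Edges inside {x
    < m} make up the core, and the pendent edges make up the product. *)
Lemma signless_laplacian_decomp n m f (G : sgraph n) : leaves_at m f G ->
  signless_laplacian R G = core_mx m G + leaf_in m f *m leaf_out m f.
Proof.
move=> att; apply/matrixP => x y; rewrite signless_laplacianE addmxE [in RHS]mxE.
have -> : (leaf_in m f *m leaf_out m f) x y =
   \sum_(s < n | (m <= s)%N) ((x == s)%:R + (f s < m)%N%:R * (x == f s)%:R) *
                         ((y == s)%:R + (y == f s)%:R).
  rewrite mxE [RHS]big_mkcond; apply: eq_bigr => s _.
  by rewrite !mxE; case: ifP => // _; rewrite mul0r.
have [xm|mx] := ltnP x m; last first.
  have -> : \sum_z (G x z)%:R = 1 :> R.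
    rewrite (eq_bigr (fun z => (z == f x)%:R * 1)) ?sum_delta // => z _.
    by rewrite att // mulr1.
  (* In the row of a leaf [x] only the column [s = x] of [leaf_in] is nonzero: [x = f s] would make
     [f s] a leaf, whose coefficient is 0. *)
  rewrite add0r (bigD1 x) //= eqxx big1 ?addr0; last first.
    move=> s /andP[ms sx]; rewrite eq_sym (negPf sx) add0r.
    by case: eqP => [E|_]; rewrite ?mulr0 ?mul0r // -E ltnNge mx mul0r mul0r.
  have -> : (f x < m)%N%:R * (x == f x)%:R = 0 :> R.
    by case: eqP => [<-|_]; rewrite ?mulr0 // ltnNge mx mul0r.
  by rewrite addr0 mul1r mulr1 att // [y == x]eq_sym.
transitivity ((x == y)%:R * (\sum_(z < n | (z < m)%N) (G x z)%:R) +
   ((x == y)%:R * (\sum_(z < n | (m <= z)%N) (G x z)%:R) + (G x y)%:R) : R).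
  rewrite addrA -mulrDr; congr (_ * _ + _).
  rewrite (bigID (fun z : 'I_n => (z < m)%N)) /=; congr (_ + _).
  by apply: eq_bigl => z; rewrite -leqNgt.
have -> : \sum_(s < n | (m <= s)%N) ((x == s)%:R + (f s < m)%N%:R * (x == f s)%:R) *
    ((y == s)%:R + (y == f s)%:R) =
  \sum_(s < n | (m <= s)%N) ((x == y)%:R * (G x s)%:R + (s == y)%:R * (G x s)%:R) :> R.
  apply: eq_bigr => s ms; have -> : (x == s) = false.
    by apply/eqP => E; move: xm; rewrite E ltnNge ms.
  rewrite add0r adj_sym att //; case: (x =P f s) => [<-|_]; last by rewrite !mulr0 mul0r addr0.
  by rewrite xm !mulr1 mul1r addrC [y == s]eq_sym [y == x]eq_sym.
rewrite big_split -mulr_sumr /=; case: ltnP => my /=.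
  rewrite [X in _ = _ + (_ + X)]big1 ?addr0; last first.
    by move=> s ms; case: eqP => [E|_]; rewrite ?mul0r //; move: my; rewrite -E ltnNge ms.
  by rewrite addrA addrAC.
have -> : (x == y) = false by apply/eqP => E; move: xm; rewrite E ltnNge my.
rewrite !mul0r !add0r (bigD1 y) //= eqxx mul1r big1 ?addr0 // => s /andP[_ /negPf ->].
by rewrite mul0r.
Qed.

Lemma leaf_sandwichE n m f (B : 'M[R]_n) s t :
  (leaf_out m f *m B *m leaf_in m f) s t =
  if (m <= s)%N && (m <= t)%N then
    B s t + B (f s) t + (f t < m)%N%:R * (B s (f t) + B (f s) (f t)) else 0.
Proof.
have outE y : (leaf_out m f *m B) s y = if (m <= s)%N then B s y + B (f s) y else 0.
  rewrite mxE; case: ifP => ms; last by rewrite big1 // => x _; rewrite mxE ms mul0r.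
  rewrite -(sum_delta s (B^~ y)) -(sum_delta (f s) (B^~ y)) -big_split.
  by apply: eq_bigr => x _; rewrite mxE ms mulrDl.
rewrite mxE; case: (leqP m s) => ms /=; last first.
  by rewrite big1 // => x _; rewrite outE leqNgt ms mul0r.
case: ifP => mt; last by rewrite big1 // => x _; rewrite [leaf_in _ _ _ _]mxE mt mulr0.
pose C y := B s y + B (f s) y.
rewrite -/(C t) -/(C (f t)) -(sum_delta t C) -(sum_delta (f t) C) mulr_sumr -big_split.
by apply: eq_bigr => x _; rewrite outE ms mxE mt mulrDr mulrC [in RHS]mulrA -/(C x) [X in _ + X]mulrC.
Qed.

(** The padding rows and columns of the core vanish, so only the identity matrix at [k = 0]
    contributes there. *)
Lemma core_exp_out n m (G : sgraph n) k (x y : 'I_n) : (m <= x)%N || (m <= y)%N ->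
  (core_mx m G ^+ k) x y = ((k == 0%N) && (x == y))%:R.
Proof.
case: k => [|k] mxy; first by rewrite expr0 mxE.
case/orP: mxy => [mx|my].
  by rewrite exprS -mulmxE mxE big1 // => z _; rewrite mxE ltnNge mx mul0r.
by rewrite exprSr -mulmxE mxE big1 // => z _; rewrite mxE [(y < m)%N]ltnNge my andbF mulr0.
Qed.

Lemma core_ge0 n m (G : sgraph n) x y : 0 <= core_mx m G x y.
Proof.
rewrite mxE; case: ifP => // _.
by rewrite addr_ge0 ?mulr_ge0 ?sumr_ge0 // => z _; exact: ler0n.
Qed.

Definition clique_on n m (G : sgraph n) :=
  forall x y : 'I_n, (x < m)%N -> (y < m)%N -> G x y = (x != y).

Lemma core_le_clique n m (G K : sgraph n) x y : clique_on m K ->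
  0 <= core_mx m G x y <= core_mx m K x y.
Proof.
move=> cK; rewrite core_ge0 !mxE; case: ifP => //= /andP[xm ym].
have le (z : 'I_n) : (z < m)%N -> (G x z)%:R <= (K x z)%:R :> R.
  move=> zm; rewrite cK // ler_nat.
  by case: eqP => [<-|_]; [rewrite adj_irr | case: (G x z)].
by rewrite lerD ?le // ler_wpM2l ?ler0n // ler_sum.
Qed.

(** The trace of the core is the sum of the induced degrees. Each is at most its value in the
    clique, so equal sums leave no edge missing. *)
Lemma core_trace_clique n m (G K : sgraph n) : clique_on m K ->
  \tr (core_mx m G) = \tr (core_mx m K) -> clique_on m G.
Proof.
move=> cK trE x y xm ym.
have diag z : core_mx m G z z = core_mx m K z z.
  have /eqP := trE; rewrite eq_sym -subr_eq0 -sumrB psumr_eq0; last first.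
    by move=> i _; rewrite subr_ge0; case/andP: (core_le_clique G i i cK).
  by move=> /allP /(_ z (mem_index_enum _)) /=; rewrite subr_eq0 => /eqP.
have /eqP := diag x; rewrite !mxE xm eqxx !mul1r !adj_irr !addr0 eq_sym -subr_eq0 -sumrB.
rewrite psumr_eq0; last first.
  move=> z zm; rewrite subr_ge0 cK // ler_nat.
  by case: eqP => [<-|_]; [rewrite adj_irr | case: (G x z)].
move=> /allP /(_ y (mem_index_enum _)) /=; rewrite ym /= subr_eq0 eqr_nat cK //.
by case: (x != y); case: (G x y).
Qed.

(* On [{x | x < m}] the core of a clique is [(m - 2) I + J]. *)
Lemma clique_core_exp n m (K : sgraph n) k : clique_on m K -> (m <= n)%N ->
  exists b, forall x y : 'I_n, (x < m)%N -> (y < m)%N ->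
    (core_mx m K ^+ k) x y = (x == y)%:R * (m%:R - 2) ^+ k + b.
Proof.
move=> cK mn; have sum1 : \sum_(z < n | (z < m)%N) 1 = m%:R :> R.
  by rewrite (big_ord_narrow mn) sumr_const card_ord.
elim: k => [|k [b IHk]].
  by exists 0 => x y xm ym; rewrite expr0 mxE addr0 mulr1.
(* The coefficient of J in ((m - 2) I + J)((m - 2)^k I + b J), since J^2 = m J. *)
exists ((m%:R - 2) * b + (m%:R - 2) ^+ k + m%:R * b) => x y xm ym.
have coreE (z : 'I_n) : (z < m)%N -> core_mx m K x z = (z == x)%:R * (m%:R - 2) + 1.
  move=> zm; rewrite mxE xm zm /= cK // [z == x]eq_sym; case: eqP => [_|_]; last first.
    by rewrite !mul0r.
  rewrite !mul1r addr0 -sum1 [in RHS](bigD1 x) //= [in LHS](bigD1 x) //= adj_irr add0r.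
  rewrite (eq_bigr (fun=> 1)) => [|w /andP[wm wx]]; last by rewrite cK // eq_sym wx.
  by ring.
rewrite exprS -mulmxE mxE (bigID (fun z : 'I_n => (z < m)%N)) /=.
rewrite [X in _ + X]big1 ?addr0; last first.
  by move=> z /negPf zm; rewrite mxE zm andbF mul0r.
rewrite (eq_bigr (fun z => (z == x)%:R * ((m%:R - 2) * (core_mx m K ^+ k) z y) +
                           (core_mx m K ^+ k) z y)); last first.
  by move=> z zm; rewrite coreE // mulrDl mul1r mulrA.
rewrite big_split /= (bigD1 x) //= eqxx mul1r [X in _ + X + _ = _]big1 ?addr0; last first.
  by move=> z /andP[_ /negPf ->]; rewrite mul0r.
rewrite (eq_bigr (fun z => (z == y)%:R * (m%:R - 2) ^+ k + 1 * b)); last first.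
  by move=> z zm; rewrite IHk // mul1r.
rewrite big_split /= -[X in _ + (_ + X) = _]mulr_suml sum1 (bigD1 y) //= eqxx mul1r.
rewrite [X in _ + (_ + X + _) = _]big1 => [|z /andP[_ /negPf ->]]; last by rewrite mul0r.
by rewrite IHk // exprS; ring.
Qed.

Lemma clique_core_exp_le n m (K : sgraph n) k (x y z : 'I_n) :
  clique_on m K -> (m <= n)%N -> (x < m)%N -> (y < m)%N -> (z < m)%N ->
  (core_mx m K ^+ k) x y <= (core_mx m K ^+ k) z z.
Proof.
move=> cK mn xm ym zm; have [b E] := clique_core_exp k cK mn.
rewrite !E // lerD2r eqxx; case: eqP => // xy.
(* Off the diagonal the claim is 0 <= (m - 2)^k. Two distinct vertices below [m] give m >= 2, which
   excludes a negative base. *)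
rewrite mul0r mul1r exprn_ge0 // subr_ge0 ler_nat.
by case: m xm ym {cK mn zm E} => [|[|m]] //; rewrite !ltnS !leqn0 => /eqP x0 /eqP y0;
  case: xy; apply: val_inj; rewrite /= x0 y0.
Qed.

(** * An arbitrary graph against a clique with all leaves at one vertex *)

Section StarComparison.
Variables (n m : nat) (G K : sgraph n) (f : 'I_n -> 'I_n) (c : 'I_n).
Hypotheses (mn : (m <= n)%N) (cm : (c < m)%N) (cK : clique_on m K).
Hypotheses (Gf : leaves_at m f G) (Kc : leaves_at m (fun=> c) K).

Lemma leaf_neq (s : 'I_n) : (m <= s)%N -> f s != s.
Proof. by move=> ms; rewrite eq_sym -(Gf s ms) adj_irr. Qed.

Lemma leaf_pair (s t : 'I_n) : (m <= s)%N -> (m <= t)%N -> f s = t -> f t = s.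
Proof.
by move=> ms mt E; apply/esym/eqP; rewrite -(Gf s mt) adj_sym (Gf t ms) E.
Qed.

(** On the right the mixed entries vanish and [B' s t + B' c c] remains. On the left, beside
    [B s t], at most one entry survives, and [B' c c], a largest entry of the clique power,
    dominates it. *)
Lemma leaf_sandwich_le k s t :
  0 <= (leaf_out m f *m core_mx m G ^+ k *m leaf_in m f) s t <=
  (leaf_out m (fun=> c) *m core_mx m K ^+ k *m leaf_in m (fun=> c)) s t.
Proof.
rewrite !leaf_sandwichE; case: ifP; rewrite ?lexx // => /andP[ms mt].
pose B := core_mx m G ^+ k; pose B' := core_mx m K ^+ k.
have BB x y : 0 <= B x y <= B' x y by apply: expmx_entry_le => i j; exact: core_le_clique.
have B0 x y : 0 <= B x y by case/andP: (BB x y).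
rewrite -/B -/B' cm mul1r; apply/andP; split.
  by rewrite !(addr_ge0, mulr_ge0) ?ler0n.
have ms' (x : 'I_n) : (m <= x)%N -> x == c = false.
  by move=> mx; apply/eqP => E; move: cm; rewrite -E ltnNge mx.
have -> : B' s c = 0 by rewrite core_exp_out ?ms // ms' // andbF.
have -> : B' c t = 0 by rewrite core_exp_out ?mt ?orbT // [c == t]eq_sym ms' // andbF.
rewrite addr0 add0r -addrA; apply: lerD; first by case/andP: (BB s t).
have B'c : 0 <= B' c c by case/andP: (BB c c) => b1 b2; apply: le_trans b2.
have [ftm|mft] := ltnP (f t) m; last first.
  (* When [f t] is a leaf, [B (f s) t] is nonzero only if [k = 0] and [f s = t]; it is then 1, which
     equals [B' c c]. *)
  rewrite mul0r addr0; have [fsm|mfs] := ltnP (f s) m; rewrite core_exp_out ?mt ?orbT //.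
    have [E|_] := eqVneq (f s) t; last by rewrite andbF.
    by move: mt; rewrite -E leqNgt fsm.
  case: k @B @B' BB B0 B'c => [|k] B B' _ _ B'c //=.
  by rewrite /B' expr0 mxE eqxx lern1 leq_b1.
rewrite mul1r; have -> : B s (f t) = 0.
  rewrite core_exp_out ?ms //; case: (s =P f t) => [E|_]; last by rewrite andbF.
  by move: ms; rewrite E leqNgt ftm.
rewrite add0r; have -> : B (f s) t = 0.
  rewrite core_exp_out ?mt ?orbT //; case: (f s =P t) => [E|_]; last by rewrite andbF.
  by move: ftm; rewrite (leaf_pair ms mt E) ltnNge ms.
rewrite add0r; have [fsm|mfs] := ltnP (f s) m.
  case/andP: (BB (f s) (f t)) => _ le; apply: le_trans le _.
  exact: clique_core_exp_le.
rewrite core_exp_out ?mfs //; case: (f s =P f t) => [E|_]; last by rewrite andbF.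
by move: ftm; rewrite -E ltnNge mfs.
Qed.

Lemma core_trace_exp_le k : \tr (core_mx m G ^+ k) <= \tr (core_mx m K ^+ k).
Proof.
by apply: trace_le; apply: expmx_entry_le => i j; exact: core_le_clique.
Qed.

Lemma trace_exp_signless_le k :
  \tr (signless_laplacian R G ^+ k) <= \tr (signless_laplacian R K ^+ k).
Proof.
rewrite (signless_laplacian_decomp Gf) (signless_laplacian_decomp Kc).
apply: trace_exp_perturb_le; [exact: leaf_sandwich_le | exact: core_trace_exp_le].
Qed.

Lemma leaf_gramE (s t : 'I_n) (Gr := leaf_out m f *m leaf_in m f) :
  (m <= s)%N -> (m <= t)%N ->
  Gr s t = (s == t)%:R + (f s == t)%:R + ((f t < m)%N && (f s == f t))%:R.
Proof.
move=> ms mt; rewrite /Gr -[leaf_out m f]mulmx1 leaf_sandwichE ms mt !mxE; congr (_ + _).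
case: ltnP => ftm /=; rewrite ?mul0r ?mul1r //.
case: eqP => [E|_]; last by rewrite add0r.
by move: ms; rewrite E leqNgt ftm.
Qed.

Lemma star_gramE (s t : 'I_n) (Gr := leaf_out m (fun=> c) *m leaf_in m (fun=> c)) :
  (m <= s)%N -> (m <= t)%N -> Gr s t = (s == t)%:R + 1.
Proof.
move=> ms mt; rewrite /Gr -[leaf_out _ _]mulmx1 leaf_sandwichE ms mt !mxE cm mul1r eqxx.
have ms' (x : 'I_n) : (m <= x)%N -> x == c = false.
  by move=> mx; apply/eqP => E; move: cm; rewrite -E ltnNge mx.
by rewrite ms' // [c == t]eq_sym ms' // addr0 add0r.
Qed.

Lemma trace_exp_signless_eq :
  (forall k, \tr (signless_laplacian R G ^+ k) = \tr (signless_laplacian R K ^+ k)) ->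
  [/\ clique_on m G, forall s : 'I_n, (m <= s)%N -> (f s < m)%N
    & forall s t : 'I_n, (m <= s)%N -> (m <= t)%N -> f s = f t].
Proof.
rewrite (signless_laplacian_decomp Gf) (signless_laplacian_decomp Kc) => E.
have := E 1; rewrite !expr1.
move=> /(trace_exp1_perturb_eq leaf_sandwich_le core_trace_exp_le)[trA tr1].
have tr2 := trace_exp2_perturb_eq leaf_sandwich_le core_trace_exp_le (E 2).
have := leaf_sandwich_le 0; rewrite !expr0 !mulmx1 => gram_le.
have cG := core_trace_clique cK trA.
(* Equal traces force equal diagonal Gram entries. At [s] these are 1 + [f s < m] for [G] and 2 for
   [K]. *)
have fm (s : 'I_n) : (m <= s)%N -> (f s < m)%N.
  move=> ms; move/eqP: tr1; rewrite eq_sym -subr_eq0 -sumrB psumr_eq0; last first.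
    by move=> i _; rewrite subr_ge0; case/andP: (gram_le i i).
  move=> /allP /(_ s (mem_index_enum _)) /=.
  rewrite leaf_gramE // star_gramE // (negPf (leaf_neq ms)) addr0 !eqxx andbT.
  by case: (f s < m)%N; rewrite // addr0 addrK oner_eq0.
split=> // s t ms mt; have [->//|st] := eqVneq s t.
have gram2_le := mulmx_entry_le gram_le gram_le.
move/eqP: tr2; rewrite eq_sym -subr_eq0 -sumrB psumr_eq0; last first.
  by move=> i _; rewrite subr_ge0; case/andP: (gram2_le i i).
(* The diagonal entry at [s] of the squared Gram matrix is a sum over [t], and it too is attained
   termwise. For [t] other than [s] the term is 1 for [K] and [f s = f t] for [G]. *)
move=> /allP /(_ s (mem_index_enum _)) /=; rewrite !mxE -sumrB psumr_eq0; last first.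
  move=> i _; rewrite subr_ge0; case/andP: (gram_le s i) => ? ?.
  by case/andP: (gram_le i s) => ? ?; rewrite ler_pM.
move=> /allP /(_ t (mem_index_enum _)) /=; rewrite !leaf_gramE // !star_gramE //.
rewrite !fm //= [t == s]eq_sym (negPf st).
have fst (x y : 'I_n) : (m <= x)%N -> (m <= y)%N -> (f x == y) = false.
  by move=> mx my; apply/eqP => e; move: (fm x mx); rewrite e ltnNge my.
rewrite (fst s t) // (fst t s) // !add0r [f t == f s]eq_sym; case: (f s =P f t) => // _.
by rewrite mulr0 mulr1 subr0 oner_eq0.
Qed.

End StarComparison.
End LeafDecomposition.

(** * Comparison with G_{n,r} *)

Lemma SLEE_trace_gap (R : realType) n (G K : sgraph n) k :
  (forall j, \tr (signless_laplacian R G ^+ j) <= \tr (signless_laplacian R K ^+ j)) ->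
  (\tr (signless_laplacian R K ^+ k) - \tr (signless_laplacian R G ^+ k)) / k`!%:R
    <= SLEE R K - SLEE R G.
Proof.
move=> le; have trE (H : sgraph n) j := trace_exp_eigenvalues j (signless_laplacian_sym R H).
by rewrite !trE; apply: sum_expR_gap => j; rewrite -!trE.
Qed.

(** The SLEE difference is at least a positive multiple of each trace difference, and these are all
    nonnegative. *)
Lemma SLEE_le_trace (R : realType) n (G K : sgraph n) :
  (forall j, \tr (signless_laplacian R G ^+ j) <= \tr (signless_laplacian R K ^+ j)) ->
  SLEE R G <= SLEE R K /\ (SLEE R G = SLEE R K -> forall j,
    \tr (signless_laplacian R G ^+ j) = \tr (signless_laplacian R K ^+ j)).
Proof.
move=> le; split.
  rewrite -subr_ge0; apply: le_trans (SLEE_trace_gap 0 le).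
  by rewrite divr_ge0 ?subr_ge0 ?le.
move=> E j; apply/eqP; rewrite eq_le le /= -subr_le0.
have := SLEE_trace_gap j le; rewrite E subrr pmulr_lle0 //.
by rewrite invr_gt0 ltr0n fact_gt0.
Qed.

(** * Relabelling the vertices *)

Section Relabeling.
Variables (n : nat) (G : sgraph n) (p : {perm 'I_n}).

Definition relabel_rel : rel 'I_n := fun x y => G (p x) (p y).

Fact relabel_sym : symmetric relabel_rel.
Proof. by move=> x y; rewrite /relabel_rel adj_sym. Qed.

Fact relabel_irr : irreflexive relabel_rel.
Proof. by move=> x; rewrite /relabel_rel adj_irr. Qed.

Definition relabel : sgraph n := SGraph relabel_sym relabel_irr.

(** Relabelling conjugates the signless Laplacian by a permutation matrix, which preserves the
    characteristic polynomial. *)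
Lemma SLEE_relabel (R : realType) : SLEE R relabel = SLEE R G.
Proof.
rewrite /SLEE /eigenvalues (_ : char_poly (signless_laplacian R relabel) =
  char_poly (signless_laplacian R G)) //.
rewrite -[RHS](char_poly_conj _ (unitmx_perm R (p^-1)%g)).
rewrite (_ : invmx _ = perm_mx p); last first.
  by rewrite -[LHS]mul1mx -perm_mx1 -(mulgV p) perm_mxM mulmxK ?unitmx_perm.
rewrite -row_permE -col_permE; congr char_poly; apply/matrixP => x y.
rewrite [in RHS]mxE [in RHS]mxE !signless_laplacianE (inj_eq perm_inj).
by congr (_ * _ + _); rewrite [RHS](reindex_perm p).
Qed.

End Relabeling.

Lemma perm_last_in n (A : {set 'I_n}) :
  exists p : {perm 'I_n}, forall x : 'I_n, (n - #|A| <= x)%N -> p x \in A.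
Proof.
have [->|/set0Pn[a _]] := eqVneq A set0.
  by exists 1%g => x; rewrite cards0 subn0 leqNgt ltn_ord.
(* The permutation lists the complement of [A] first, so the last positions fall in [A]; [a] is the
   default of [nth]. *)
pose s := enum (~: A) ++ enum A.
have us : uniq s.
  rewrite cat_uniq !enum_uniq andbT /=; apply/hasPn => x.
  by rewrite !mem_enum inE negbK.
have ss : size s = n by rewrite size_cat -!cardE addnC cardsC card_ord.
have p_inj : injective (fun x : 'I_n => nth a s x).
  by move=> x y /eqP; rewrite nth_uniq ?ss // => /eqP; exact: val_inj.
have An : (#|A| <= n)%N by have := max_card A; rewrite card_ord.
have CA : #|~: A| = (n - #|A|)%N.
  by apply/eqP; rewrite -(eqn_add2l #|A|) cardsC card_ord subnKC.
exists (perm p_inj) => x Ax; rewrite permE nth_cat -cardE CA ltnNge Ax /=.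
by rewrite -mem_enum mem_nth // -cardE ltn_subLR // subnK.
Qed.

Lemma Gnr_clique n r : clique_on (n - r) (Gnr n r).
Proof. by move=> x y xm ym; rewrite /= /Gnr_rel xm ym /= andbT. Qed.

Lemma Gnr_leaves n r (c : 'I_n) : c = 0 :> nat -> (r < n)%N ->
  leaves_at (n - r) (fun=> c) (Gnr n r).
Proof.
move=> c0 rn s y ms; rewrite /= /Gnr_rel ltnNge ms /= -[y == c]val_eqE /= c0.
have s0 : (0 < s)%N by apply: leq_trans ms; rewrite subn_gt0.
rewrite eqn0Ngt s0 /= andbT -val_eqE /=.
by case: (val y =P 0%N) => [->|_]; rewrite ?andbF // andbT -lt0n.
Qed.

(** The transposition of [c] and [d] moves only clique vertices: it preserves the clique, fixes
    every leaf and carries the common neighbour [d] to vertex 0. *)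
Lemma isomorphic_Gnr n r (G : sgraph n) (c d : 'I_n) :
  c = 0 :> nat -> (r < n)%N -> (d < n - r)%N -> clique_on (n - r) G ->
  leaves_at (n - r) (fun=> d) G ->
  forall x y, Gnr n r (tperm c d x) (tperm c d y) = G x y.
Proof.
move=> c0 rn dm cG Gd; have cm : (c < n - r)%N by rewrite c0 subn_gt0.
have tm (x : 'I_n) : (x < n - r)%N -> (tperm c d x < n - r)%N by case: tpermP => // ->.
have ts (x : 'I_n) : (n - r <= x)%N -> tperm c d x = x.
  by move=> mx; case: tpermP => // E; move: mx; rewrite E leqNgt ?cm ?dm.
have leafE (x y : 'I_n) : (n - r <= x)%N -> Gnr n r (tperm c d x) (tperm c d y) = G x y.
  move=> mx; rewrite (ts x) // (Gnr_leaves c0 rn) // Gd //.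
  by rewrite -(inj_eq (@perm_inj _ (tperm c d))) tpermK tpermL.
move=> x y; have [xm|/leafE->//] := ltnP x (n - r).
have [ym|my] := ltnP y (n - r); last by rewrite adj_sym leafE // adj_sym.
by rewrite Gnr_clique ?tm // cG // (inj_eq perm_inj).
Qed.

Lemma pendent_leaf n (G : sgraph n) : exists f : 'I_n -> 'I_n,
  forall x, x \in pendent G -> forall y, G x y = (y == f x).
Proof.
exists (fun x => odflt x [pick y | G x y]) => x; rewrite inE => /cards1P[z E] y.
have Gx w : G x w = (w == z) by move/setP/(_ w): E; rewrite !inE.
by case: pickP => [w|/(_ z)]; rewrite !Gx ?eqxx // => /eqP ->.
Qed.

(** The pendent vertices receive the last labels, and the final [r] of them are split off as leaves.
    Any further one stays in {x < n - r}, where the induced graph is arbitrary, so at least [r]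
    pendent vertices suffice. *)
Lemma SLEE_max_Gnr (R : realType) n r (G : sgraph n) : (r < n)%N ->
  (r <= #|pendent G|)%N ->
  SLEE R G <= SLEE R (Gnr n r) /\ (SLEE R G = SLEE R (Gnr n r) -> isomorphic G (Gnr n r)).
Proof.
move=> rn rG; have n_gt0 : (0 < n)%N by exact: leq_ltn_trans rn.
have [p pP] := perm_last_in (pendent G); have [g gP] := pendent_leaf G.
pose H := relabel G p; pose f x := (p^-1)%g (g (p x)).
have Hf : leaves_at (n - r) f H.
  move=> s y ms; rewrite /= /relabel_rel gP; last by rewrite pP // (leq_trans _ ms) ?leq_sub2l.
  by rewrite -[in RHS](inj_eq (@perm_inj _ p)) permKV.
pose c := Ordinal n_gt0; have cm : (c < n - r)%N by rewrite subn_gt0.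
have Kc := @Gnr_leaves n r c erefl rn.
have [le eq] := SLEE_le_trace (fun k =>
  trace_exp_signless_le R (leq_subr r n) cm (@Gnr_clique n r) Hf Kc k).
rewrite -(SLEE_relabel G p); split=> // /eq trE.
have [cH fm fconst] := trace_exp_signless_eq (leq_subr r n) cm (@Gnr_clique n r) Hf Kc trE.
have [d dm Hd] : exists2 d : 'I_n, (d < n - r)%N & leaves_at (n - r) (fun=> d) H.
  have [s ms|no_leaf] := pickP (fun s : 'I_n => (n - r <= s)%N).
    by exists (f s); [exact: fm | move=> t y mt; rewrite Hf // (fconst t s)].
  (* Without leaves the condition on [d] is vacuous, and [c] is as good as any vertex of the
     clique. *)
  by exists c => // s y ms; have := no_leaf s; rewrite /= ms.
pose t := tperm c d; exists (fun x => t ((p^-1)%g x)).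
  by exists (fun x => p ((t^-1)%g x)) => x; rewrite ?permK ?permKV // -[RHS]permK permKV.
by move=> x y; rewrite (isomorphic_Gnr (erefl : c = 0%N :> nat) rn dm cH Hd) /= /relabel_rel !permKV.
Qed.

Lemma Gnr_pendentE n r (x : 'I_n) : (r < n)%N -> (n - r <= x)%N ->
  x \in pendent (Gnr n r).
Proof.
move=> rn mx; have n_gt0 : (0 < n)%N by exact: leq_ltn_trans rn.
rewrite inE; apply/cards1P; exists (Ordinal n_gt0).
by apply/setP => y; rewrite !inE (@Gnr_leaves n r (Ordinal n_gt0)).
Qed.

Lemma card_ge_ord n r : (r <= n)%N -> #|[set x : 'I_n | (n - r <= x)%N]| = r.
Proof.
move=> rn; rewrite -sum1dep_card -(big_mkord (leq (n - r)) (fun=> 1%N)).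
rewrite (big_cat_nat (n := n - r)) ?leq_subr //= big_nat_cond big1 ?add0n.
  rewrite big_nat_cond (eq_bigl (fun i => n - r <= i < n)%N) -?big_nat.
    by rewrite sum_nat_const_nat muln1 subKn.
  by move=> i; case: (n - r <= i)%N; rewrite ?andbT ?andbF.
by move=> i; case: ltnP; rewrite ?andbF.
Qed.

Lemma card_pendent_Gnr_ge n r : (r < n)%N -> (r <= #|pendent (Gnr n r)|)%N.
Proof.
move=> rn; rewrite -[X in (X <= _)%N](card_ge_ord (ltnW rn)); apply: subset_leq_card.
by apply/subsetP => x; rewrite inE; exact: Gnr_pendentE.
Qed.

Lemma card_pendent_Gnr n r : (r < n)%N -> n <> (r + 2)%N ->
  ~ (n = 2%N /\ r = 1%N) -> #|pendent (Gnr n r)| = r.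
Proof.
move=> rn n_r2 n2; have n_gt0 : (0 < n)%N by exact: leq_ltn_trans rn.
rewrite -[RHS](card_ge_ord (ltnW rn)); apply: eq_card => x; rewrite [in RHS]inE.
apply/idP/idP => [xP|]; last exact: Gnr_pendentE.
rewrite leqNgt; apply/negP => xm; have [f fP] := pendent_leaf (Gnr n r).
(* Suppose [x < n - r] is pendent. Every other clique vertex, and every other vertex at all if [x]
   is 0, is adjacent to [x] and hence equals [f x]; two such vertices give a contradiction. *)
have fE i (lt_in : (i < n)%N) : (i != x :> nat) -> (i < n - r)%N || (x == 0 :> nat) ->
    i = f x :> nat.
  move=> ix im; suff /eqP <- : Ordinal lt_in == f x by [].
  rewrite -fP //= /Gnr_rel -val_eqE /= eq_sym ix /= xm /=.
  by case/orP: im => [->//|->]; case: ltnP.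
have f_neq : f x != x by rewrite eq_sym -fP // adj_irr.
have [n3|n_lt3] := leqP 3 (n - r).
  have lt_n i : (i < 3)%N -> (i < n)%N by lia.
  have := fE 0%N (lt_n 0%N isT); have := fE 1%N (lt_n 1%N isT).
  have := fE 2%N (lt_n 2%N isT); lia.
(* Now [n - r = 1], because [n = r + 2] is excluded, so [x] is the centre of a star. As [n = 2] is
   excluded too, vertices 1 and 2 both exist. *)
have x0 : x = 0 :> nat by lia.
have fx_lt := ltn_ord (f x).
have fx0 : f x <> x :> nat by move=> E; case/eqP: f_neq; apply: val_inj.
have lt1 : (1 < n)%N by lia.
have lt2 : (2 < n)%N by lia.
have := fE 1%N lt1; have := fE 2%N lt2; lia.
Qed.

Local Close Scope ring_scope.

(** For the pairs excluded in the first part, [Gnr n r] has more than [r] pendent vertices: the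
    second vertex of K_2 is pendent if n = r + 2, and the centre is if n = 2 and r = 1. It still
    lies in the class of the second part. *)
Theorem theorem4p4 (R : realType) (n r : nat) (hn : 1 <= n)
    (hr : r <= n - 1) :
  (n <> r + 2 -> ~ (n = 2 /\ r = 1) ->
     unique_max_SLEE R (fun H : sgraph n => #|pendent H| = r) (Gnr n r)) /\
  unique_max_SLEE R (fun H : sgraph n => r <= #|pendent H|) (Gnr n r).
Proof.
have rn : r < n by rewrite -(subnK hn) addn1 ltnS.
split=> [n_r2 n2|]; split.
- exact: card_pendent_Gnr.
- by move=> H rH; apply: SLEE_max_Gnr; rewrite ?rH.
- exact: card_pendent_Gnr_ge.
- by move=> H rH; exact: SLEE_max_Gnr.
Qed.
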